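(* Let $H=H(\mathbf{g},\mathbf{\chi},\mathbf{\lambda})$ be a lifting of a Quantum Linear Space over a field $\mathbf{k}$ (as defined in the context), let $\rho$ be its Nakayama automorphism with respect to a nonzero right integral of $H^*$, let $\alpha\in H^*$ be its modular element, let $L_1=\langle q_{11},\ldots,q_{nn},\alpha(G)\rangle\subseteq\mathbf{k}^*$ and $L_2=\alpha(G)\subseteq L_1$, and for $\omega\in L_1$ let $H_\omega=\{h\in H:\rho(h)=\omega h\}$, so that $H=\bigoplus_{\omega\in L_1}H_\omega$ is an $L_1$-grading of the algebra $H$. The following are equivalent: (1) the $L_1$-grading $H=\bigoplus_{\omega\in L_1}H_\omega$ is strongly graded; (2) each component $H_\omega$ ($\omega\in L_1$) contains an element of $G$; (3) $L_1=L_2$; (4) $H$ is a crossed product $H_1\ltimes\mathbf{k}L_1$.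
   Context: Lifting of a Quantum Linear Space: $\mathbf{k}$ is a field, $G$ is a finite abelian group, $g_1,\ldots,g_n\in G$, and $\chi_1,\ldots,\chi_n\in\hat G$ are characters $G\to\mathbf{k}^*$ such that $\chi_i(g_i)\neq 1$ for all $i$ and $\chi_i(g_j)\chi_j(g_i)=1$ for $i\neq j$. Put $q_{ij}=\chi_j(g_i)$ and let $m_i$ be the multiplicative order of $q_{ii}$. Let $\lambda_i\in\mathbf{k}$ and, for $i\ne j$, $\lambda_{ij}\in\mathbf{k}$ be scalars such that $\lambda_i(\chi_i^{m_i}-\varepsilon)=0$ and $\lambda_{ij}(\chi_i\chi_j-\varepsilon)=0$ (with $\varepsilon$ the trivial character), and $\lambda_{ij}+q_{ij}\lambda_{ji}=0$ for $i\neq j$. Then $H=H(\mathbf{g},\mathbf{\chi},\mathbf{\lambda})$ is the $\mathbf{k}$-algebra generated by $G$ (with the relations of $G$) and $x_1,\ldots,x_n$, subject to $gx_i=\chi_i(g)x_ig$ for $g\in G$; $x_ix_j=q_{ij}x_jx_i+\lambda_{ij}(1-g_ig_j)$ for $i\neq j$; $x_i^{m_i}=\lambda_i(1-g_i^{m_i})$. It is well known that $\{x_1^{r_1}\cdots x_n^{r_n}g:0\le r_i<m_i,\ g\in G\}$ is a basis of $H$. It is a Hopf algebra with $\Delta(g)=g\otimes g$, $\Delta(x_i)=g_i\otimes x_i+x_i\otimes 1$, counit $\varepsilon(g)=1$, $\varepsilon(x_i)=0$, antipode $S(g)=g^{-1}$, $S(x_i)=-g_i^{-1}x_i$. Nakayama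 automorphism: for a finite dimensional Hopf algebra $H$, a nonzero right integral $\varphi\in H^*$ (i.e. $\varphi * f=f(1)\varphi$ for all $f\in H^*$) is a Frobenius homomorphism, and $\rho$ is the algebra automorphism determined by $\varphi(ax)=\varphi(\rho(x)a)$ for all $a,x\in H$. It does not depend on the choice of $\varphi$, and it satisfies $\rho(h)=\alpha(S(h_{(1)}))S^2(h_{(2)})$. Modular element: if $t\in H$ is a nonzero right integral ($th=\varepsilon(h)t$ for all $h$), then $\alpha\colon H\to\mathbf{k}$ is the algebra map given by $ht=\alpha(h)t$. In the present case $\alpha(x_i)=0$ and $\alpha(g)=\chi_1^{m_1-1}(g)\cdots\chi_n^{m_n-1}(g)$ for $g\in G$; also $\rho(g)=\alpha(g^{-1})g$ and $\rho(x_i)=\alpha(g_i^{-1})q_{ii}^{-1}x_i$. A grading $A=\bigoplus_{g\in L}A_g$ of an algebra by a group $L$ is strongly graded if $A_gA_h=A_{gh}$ for all $g,h\in L$. ''$H$ is a crossed product $H_1\ltimes\mathbf{k}L_1$'' is understood with respect to the given $L_1$-grading: it means that every component $H_\omega$, $\omega\in L_1$, contains an invertible element of $H$. Here $H_1$ is the component of $\omega=1$. *)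

(* Defs.v *)
From mathcomp Require Import all_boot all_algebra fingroup falgebra.

Set Implicit Arguments.
Unset Strict Implicit.
Unset Printing Implicit Defensive.

Import GRing.Theory.
Local Open Scope ring_scope.

(* An element of the tensor product of A with A is represented by a finite    *)
(* list of pairs, [:: (a_1, b_1); ...; (a_r, b_r)] standing for the sum of    *)
(* the tensors a_i (x) b_i.  Two lists represent the same tensor iff every    *)
(* bilinear map gives them the same value.  Triple tensors are treated alike. *)

Definition bilinear_map (k : fieldType) (A V : lmodType k) (f : A -> A -> V) :=
  (forall a, linear (f a)) /\ (forall b, linear (f^~ b)).

Definition trilinear_map (k : fieldType) (A V : lmodType k)
    (f : A -> A -> A -> V) :=
  [/\ forall a b, linear (f a b), forall a c, linear (fun b => f a b c)
    & forall b c, linear (fun a => f a b c)].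

Definition tensor_eq (k : fieldType) (A : lmodType k) (s t : seq (A * A)) :=
  forall (V : lmodType k) (f : A -> A -> V), bilinear_map f ->
    \sum_(u <- s) f u.1 u.2 = \sum_(u <- t) f u.1 u.2.

Definition tensor3_eq (k : fieldType) (A : lmodType k)
    (s t : seq (A * A * A)) :=
  forall (V : lmodType k) (f : A -> A -> A -> V), trilinear_map f ->
    \sum_(u <- s) f u.1.1 u.1.2 u.2 = \sum_(u <- t) f u.1.1 u.1.2 u.2.

Definition tensor_scale (k : fieldType) (A : lmodType k) (c : k)
    (s : seq (A * A)) := [seq (c *: u.1, u.2) | u <- s].

Definition tensor_mul (k : fieldType) (A : algType k) (s t : seq (A * A)) :=
  [seq (u.1 * v.1, u.2 * v.2) | u <- s, v <- t].

(* comul h is a list of pairs representing h_(1) (x) h_(2). *)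
Record hopf_structure (k : fieldType) (A : algType k) := HopfStructure {
  comul : A -> seq (A * A);
  counit : {lrmorphism A -> k | *%R};
  antipode : {linear A -> A};
  comul_linear : forall c a b,
    tensor_eq (comul (c *: a + b)) (tensor_scale c (comul a) ++ comul b);
  comul_1 : tensor_eq (comul 1) [:: (1, 1)];
  comul_mul : forall a b,
    tensor_eq (comul (a * b)) (tensor_mul (comul a) (comul b));
  comul_coassoc : forall a,
    tensor3_eq [seq (v.1, v.2, u.2) | u <- comul a, v <- comul u.1]
               [seq (u.1, v.1, v.2) | u <- comul a, v <- comul u.2];
  counitl : forall a, \sum_(u <- comul a) counit u.1 *: u.2 = a;
  counitr : forall a, \sum_(u <- comul a) counit u.2 *: u.1 = a;
  antipodel : forall a, \sum_(u <- comul a) antipode u.1 * u.2 = (counit a)%:A;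
  antipoder : forall a, \sum_(u <- comul a) u.1 * antipode u.2 = (counit a)%:A
}.

Definition convolution (k : fieldType) (A : algType k) (X : hopf_structure A)
    (f f' : A -> k) (h : A) : k :=
  \sum_(u <- comul X h) f u.1 * f' u.2.

Definition dual_right_integral (k : fieldType) (A : algType k)
    (X : hopf_structure A) (phi : {scalar A}) :=
  forall (f : {scalar A}) (h : A), convolution X phi f h = f 1 * phi h.

Definition right_integral (k : fieldType) (A : algType k)
    (X : hopf_structure A) (t : A) :=
  forall h : A, t * h = counit X h *: t.

Definition nakayama (k : fieldType) (A : algType k) (phi : {scalar A})
    (rho : {lrmorphism A -> A}) :=
  bijective rho /\ forall a x : A, phi (a * x) = phi (rho x * a).

Definition modular (k : fieldType) (A : algType k) (t : A)
    (alpha : {lrmorphism A -> k | *%R}) :=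
  forall h : A, h * t = alpha h *: t.

(* The group is the whole type gT.  The values qchar i are units of k by the  *)
(* first two axioms.  The diagonal of qll is irrelevant.                      *)
Record lifting_datum (k : fieldType) (gT : finGroupType) (n : nat) :=
  LiftingDatum {
  qg : 'I_n -> gT;
  qchar : 'I_n -> gT -> k;
  qord : 'I_n -> nat;
  ql : 'I_n -> k;
  qll : 'I_n -> 'I_n -> k;
  qgroup_abelian : abelian [set: gT];
  qchar1 : forall i, qchar i 1%g = 1;
  qcharM : forall i a b, qchar i (a * b)%g = qchar i a * qchar i b;
  qchar_neq1 : forall i, qchar i (qg i) != 1;
  qchar_inv : forall i j, i != j -> qchar i (qg j) * qchar j (qg i) = 1;
  qordP : forall i, (qord i).-primitive_root (qchar i (qg i));
  qlP : forall i a, ql i * (qchar i a ^+ qord i - 1) = 0;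
  qllP : forall i j a, i != j -> qll i j * (qchar i a * qchar j a - 1) = 0;
  qll_antisym : forall i j, i != j ->
    qll i j + qchar j (qg i) * qll j i = 0
}.

Definition qmat (k : fieldType) (gT : finGroupType) (n : nat)
    (D : lifting_datum k gT n) (i j : 'I_n) : k := qchar D j (qg D i).

Record lifting_relations (k : fieldType) (gT : finGroupType) (n : nat)
    (D : lifting_datum k gT n) (B : algType k)
    (u : gT -> B) (y : 'I_n -> B) : Prop := LiftingRelations {
  rel_one : u 1%g = 1;
  rel_mul : forall a b, u (a * b)%g = u a * u b;
  rel_gx : forall a i, u a * y i = qchar D i a *: (y i * u a);
  rel_xx : forall i j, i != j ->
    y i * y j = qmat D i j *: (y j * y i)
                + qll D i j *: (1 - u (qg D i * qg D j)%g);
  rel_xpow : forall i,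
    y i ^+ qord D i = ql D i *: (1 - u (qg D i ^+ qord D i)%g)
}.

(* (A, u, y) is the algebra presented by the generators gT, x_1, ..., x_n and *)
(* the relations above.                                                       *)
Definition lifting_presentation (k : fieldType) (gT : finGroupType) (n : nat)
    (D : lifting_datum k gT n) (A : algType k)
    (u : gT -> A) (y : 'I_n -> A) : Prop :=
  lifting_relations D u y /\
  forall (B : algType k) (v : gT -> B) (z : 'I_n -> B),
    lifting_relations D v z ->
    exists F : {lrmorphism A -> B},
      [/\ forall a, F (u a) = v a, forall i, F (y i) = z i
        & forall F' : {lrmorphism A -> B},
            (forall a, F' (u a) = v a) -> (forall i, F' (y i) = z i) ->
            F' =1 F].

Definition lifting_hopf (k : fieldType) (gT : finGroupType) (n : nat)
    (D : lifting_datum k gT n) (A : algType k)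
    (u : gT -> A) (y : 'I_n -> A) (X : hopf_structure A) : Prop :=
  [/\ forall a, tensor_eq (comul X (u a)) [:: (u a, u a)],
      forall i, tensor_eq (comul X (y i)) [:: (u (qg D i), y i); (y i, 1)],
      (forall a, counit X (u a) = 1) /\ (forall i, counit X (y i) = 0),
      forall a, antipode X (u a) = u a^-1%g
    & forall i, antipode X (y i) = - (u (qg D i)^-1%g * y i)].

(* The subgroup of the multiplicative group of k generated by a set P of      *)
(* nonzero elements.                                                          *)
Inductive mul_span (k : fieldType) (P : k -> Prop) : k -> Prop :=
| MulSpanGen w of P w : mul_span P w
| MulSpan1 : mul_span P 1
| MulSpanM w w' of mul_span P w & mul_span P w' : mul_span P (w * w')
| MulSpanV w of mul_span P w : mul_span P w^-1.

Definition char_image (k : fieldType) (gT : finGroupType) (A : algType k)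
    (u : gT -> A) (alpha : A -> k) (w : k) : Prop :=
  exists a : gT, w = alpha (u a).

Definition nakayama_group (k : fieldType) (gT : finGroupType) (n : nat)
    (D : lifting_datum k gT n) (A : algType k)
    (u : gT -> A) (alpha : A -> k) : k -> Prop :=
  mul_span (fun w => (exists i, w = qmat D i i) \/ char_image u alpha w).

Definition nakayama_component (k : fieldType) (A : falgType k)
    (rho : {lrmorphism A -> A}) (w : k) : {vspace A} :=
  passmx.leigenspace (linfun rho) w.

(* In the next three definitions, L is a subgroup of the multiplicative group *)
(* of k, and only the components A_ w with w in L matter.                     *)

Definition group_grading (k : fieldType) (A : falgType k) (L : k -> Prop)
    (A_ : k -> {vspace A}) : Prop :=
  [/\ forall w w', L w -> L w' -> (A_ w * A_ w' <= A_ (w * w')%R)%VS,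
      forall h : A, exists2 s : seq k, (forall w, w \in s -> L w)
        & h \in (\sum_(w <- s) A_ w)%VS
    & forall (s : seq k) (f : k -> A), uniq s ->
        (forall w, w \in s -> L w /\ f w \in A_ w) ->
        \sum_(w <- s) f w = 0 -> forall w, w \in s -> f w = 0].

Definition strongly_graded (k : fieldType) (A : falgType k) (L : k -> Prop)
    (A_ : k -> {vspace A}) : Prop :=
  forall w w', L w -> L w' -> (A_ w * A_ w')%VS = A_ (w * w')%R.

Definition crossed_product (k : fieldType) (A : falgType k) (L : k -> Prop)
    (A_ : k -> {vspace A}) : Prop :=
  forall w, L w -> exists2 h : A, h \in A_ w & h \is a GRing.unit.

(* Main.v *)
Require Import Defs.
From HB Require Import structures.
From mathcomp Require Import all_boot all_algebra fingroup falgebra.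

Set Implicit Arguments.
Unset Strict Implicit.
Unset Printing Implicit Defensive.

Import GRing.Theory.
Local Open Scope ring_scope.

(** The four conditions are compared through two algebra maps that are known
    on generators: the Nakayama automorphism rho and the counit.

    Computing rho.  For b and a in H let slice b a be the contraction of the
    coproduct of b against phi (a -), that is the sum of phi (a b_1) b_2.  As
    phi is a right integral, slice b 1 = phi b.  For the modular integral t, the
    identities g t = alpha g t, x_i t = 0, t g = t and t x_i = 0, expanded
    with the coproducts of g and x_i, give both slice t g, slice t x_i and
    slice t (rho g), slice t (rho x_i) explicitly.  They are proportional, so
    rho g = alpha(g)^-1 g and rho x_i = alpha(g_i)^-1 q_ii^-1 x_i once slice t
    is injective.  The same identities show that its image contains (phi t) 1 and
    is stable under right multiplication by the generators, so slice t is onto,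
    hence injective, as soon as phi t is nonzero.  This last fact comes from the
    nondegeneracy of phi (frobenius_nondegenerate): the radical of phi is a
    two-sided ideal and a coideal on one side, and the antipode axiom forces
    such a proper ideal to be zero.

    Comparing the conditions.  The generators are eigenvectors of rho with
    eigenvalues in L1, so H is the sum of its eigenspaces H_w, and the sum is
    direct.  The key point is counit_component: the counit vanishes on H_w
    unless w lies in L2.  Indeed, if M is the order of L2 = alpha(G), then
    the counit is invariant under rho^M, since this holds on G and both sides
    vanish on the x_i.  So w^M = 1 when the counit is nonzero on H_w, and all
    M-th roots of unity of k are already in alpha(G).  If the grading is strong,
    1 is in H_w H_(w^-1), and as its counit is 1, w must be in L2: thus
    L1 = L2, and g^-1 lies in H_w for w = alpha(g).  Group elements are
    invertible, and a graded algebra with a unit in each component is strongly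
    graded. *)

(** * Generation by products *)

Definition lin_closed (k : fieldType) (V : lmodType k) (P : V -> Prop) :=
  P 0 /\ forall c a b, P a -> P b -> P (c *: a + b).

Lemma span_lin_closed (k : fieldType) (V : vectType k) (P : V -> Prop)
    (s : seq V) :
  lin_closed P -> (forall v, v \in s -> P v) -> forall v, v \in <<s>>%VS -> P v.
Proof.
move=> [P0 Plin] Ps v /(@coord_span _ _ _ (in_tuple s)) ->.
elim/big_rec: _ => // i w _ Pw; apply: Plin Pw.
by apply: Ps; rewrite mem_nth.
Qed.

Lemma prodv_lin_closed (k : fieldType) (A : falgType k) (P : A -> Prop)
    (U V : {vspace A}) :
    lin_closed P -> (forall a b, a \in U -> b \in V -> P (a * b)) ->
  forall h, h \in (U * V)%VS -> P h.
Proof.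
move=> Plin PUV h; rewrite unlock; apply: span_lin_closed => //.
by move=> _ /allpairsP[[a b] [/vbasis_mem Ua /vbasis_mem Vb ->]]; apply: PUV.
Qed.

Lemma agenv_lin_closed (k : fieldType) (A : falgType k) (P : A -> Prop)
    (s : seq A) :
    lin_closed P -> P 1 -> (forall h u, P h -> u \in s -> P (h * u)) ->
  forall h, h \in agenv <<s>>%VS -> P h.
Proof.
move=> Plin P1 PM h; have [P0 PD] := Plin.
have PsM g u : P g -> u \in <<s>>%VS -> P (g * u).
  move=> Pg; apply: (@span_lin_closed _ _ (fun u => P (g * u))).
    by split=> [|c a b Pa Pb]; rewrite ?mulr0 // mulrDr -scalerAr; apply: PD.
  by move=> v; apply: PM.
rewrite /agenv.
have Pexp i g : g \in (<<s>> ^+ i)%VS -> P g.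
  elim: i g => [|i IHi] g.
    rewrite expv0 => /vlineP[c ->]; rewrite -[_ *: _]addr0; exact: PD.
  by rewrite expvSr; apply: prodv_lin_closed => // a b /IHi; apply: PsM.
move=> /memv_sumP[f fP ->].
elim/big_rec: _ => // i w _ Pw; rewrite -[f i]scale1r; apply: PD Pw.
exact: Pexp (fP i isT).
Qed.

(** * Algebras given by the lifting presentation *)

Section Presentation.

Variables (k : fieldType) (gT : finGroupType) (n : nat).
Variables (D : lifting_datum k gT n) (H : falgType k).
Variables (iota : gT -> H) (x : 'I_n -> H).
Hypothesis presH : lifting_presentation D iota x.

(** Such a subalgebra satisfies the relations, so H maps to it; followed by
    the inclusion this map is an endomorphism of H fixing the generators, hence
    the identity by the uniqueness part of the universal property. *)
Lemma presentation_aspace (A : {aspace H}) :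
    1 \in A -> (forall a, iota a \in A) -> (forall i, x i \in A) ->
  forall h, h \in A.
Proof.
move=> A1 Ag Ax h; have [relH univ] := presH.
have alg1 : algid A = 1 by apply/eqP; rewrite algid_eq1.
pose v a : subvs_of A := Subvs (Ag a); pose z i : subvs_of A := Subvs (Ax i).
have valX (w : subvs_of A) m : vsval (w ^+ m) = vsval w ^+ m.
  by elim: m => [|m IH]; rewrite ?expr0 // !exprS -IH.
have relA : lifting_relations D v z.
  case: relH => r1 rM rgx rxx rxp; split.
  - by apply: val_inj; rewrite /= r1 alg1.
  - by move=> a b; apply: val_inj; rewrite /= rM.
  - by move=> a i; apply: val_inj; rewrite /= rgx.
  - by move=> i j ne; apply: val_inj; rewrite /= rxx //= alg1.
  - by move=> i; apply: val_inj; rewrite [LHS]valX /= rxp alg1.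
have [F [Fg Fx _]] := univ _ _ _ relA.
have [I [_ _ uniq]] := univ _ _ _ relH.
pose F' h := vsval (F h).
have F'D : linear F' by move=> c a b; rewrite /F' linearP.
have F'M : monoid_morphism F'.
  by split=> [|a b]; rewrite /F' ?rmorph1 ?rmorphM //= alg1.
pose mlin := GRing.isLinear.Build k H H *:%R F' F'D.
pose mmor := GRing.isMonoidMorphism.Build H H F' F'M.
pose F'' : {lrmorphism H -> H} := HB.pack F' mlin mmor.
have EF := uniq F'' (fun a => congr1 vsval (Fg a))
  (fun i => congr1 vsval (Fx i)).
have EI := uniq (idfun : {lrmorphism H -> H}) (fun=> erefl) (fun=> erefl).
by rewrite -[h]/(idfun h) EI -EF; apply: valP.
Qed.

(** H is spanned by the words in the generators; these are built by right
    multiplication, which is the side on which the slices below behave well. *)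
Lemma presentation_ind (P : H -> Prop) :
    lin_closed P -> P 1 ->
    (forall h a, P h -> P (h * iota a)) -> (forall h i, P h -> P (h * x i)) ->
  forall h, P h.
Proof.
move=> Plin P1 Pg Px h; pose s := codom iota ++ codom x.
have sub u : u \in s -> u \in agenv <<s>>%VS.
  by move=> su; apply: (subvP (sub_agenv _)); apply: memv_span.
apply: (@agenv_lin_closed _ _ P s) => //.
  by move=> g u Pu; rewrite mem_cat => /orP[] /codomP[y ->]; auto.
apply: presentation_aspace => [|a|i].
- by apply: (subvP (sub1_agenv _)); apply: memv_line.
- by apply: sub; rewrite mem_cat codom_f.
by apply: sub; rewrite mem_cat codom_f orbT.
Qed.

End Presentation.

(** * Contracting the coproduct *)

Section Slice.

Variables (k : fieldType) (A : algType k) (X : hopf_structure A).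
Variable phi : {scalar A}.

Lemma comul_mul_sum (V : lmodType k) (f : A -> A -> V) (a b : A) :
    bilinear_map f ->
  \sum_(u <- comul X (a * b)) f u.1 u.2 =
  \sum_(u <- comul X a) \sum_(v <- comul X b) f (u.1 * v.1) (u.2 * v.2).
Proof. by move=> bf; rewrite (comul_mul X a b bf) big_allpairs_dep. Qed.

Lemma bilinear_mull (V : lmodType k) (f : A -> A -> V) (c d : A) :
  bilinear_map f -> bilinear_map (fun p q => f (c * p) (d * q)).
Proof.
by case=> fl fr; split=> [a|b] e p q; rewrite mulrDr -scalerAr ?fl //;
   apply: fr.
Qed.

Lemma bilinear_mulr (V : lmodType k) (f : A -> A -> V) (c d : A) :
  bilinear_map f -> bilinear_map (fun p q => f (p * c) (q * d)).
Proof.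
by case=> fl fr; split=> [a|b] e p q; rewrite mulrDl -scalerAl ?fl //;
   apply: fr.
Qed.

(** The sum over the coproduct of b is kept outermost, so that for an explicit
    s a contraction at a product becomes a combination of contractions at b. *)
Lemma comul_mull_sum (V : lmodType k) (f : A -> A -> V) (a b : A) s :
    bilinear_map f -> tensor_eq (comul X a) s ->
  \sum_(u <- comul X (a * b)) f u.1 u.2 =
  \sum_(v <- comul X b) \sum_(u <- s) f (u.1 * v.1) (u.2 * v.2).
Proof.
move=> bf Es; rewrite comul_mul_sum // exchange_big /=.
by apply: eq_bigr => v _; apply: (Es _ _ (bilinear_mulr v.1 v.2 bf)).
Qed.

Lemma comul_mulr_sum (V : lmodType k) (f : A -> A -> V) (a b : A) s :
    bilinear_map f -> tensor_eq (comul X a) s ->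
  \sum_(u <- comul X (b * a)) f u.1 u.2 =
  \sum_(v <- comul X b) \sum_(u <- s) f (v.1 * u.1) (v.2 * u.2).
Proof.
move=> bf Es; rewrite comul_mul_sum //.
by apply: eq_bigr => v _; apply: (Es _ _ (bilinear_mull v.1 v.2 bf)).
Qed.

(** The contraction (phi (a -) (x) id) of the coproduct of b. *)
Definition slice (b a : A) : A := \sum_(u <- comul X b) phi (a * u.1) *: u.2.

Lemma slice_bilinear a : bilinear_map (fun p q : A => phi (a * p) *: q).
Proof.
split=> [p|q] c y z; first by rewrite scalerDr !scalerA mulrC.
by rewrite mulrDr -scalerAr linearP scalerDl scalerA.
Qed.

Lemma slice_linear b : linear (slice b).
Proof.
move=> c y z; rewrite /slice scaler_sumr -big_split /=; apply: eq_bigr => u _.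
by rewrite mulrDl -scalerAl linearP scalerDl scalerA.
Qed.

Lemma slice_linearl a : linear (slice^~ a).
Proof.
move=> c y z; rewrite /slice (comul_linear X c y z (slice_bilinear a)).
rewrite big_cat big_map scaler_sumr /=; congr (_ + _); apply: eq_bigr => u _.
by rewrite -scalerAr linearZ scalerA.
Qed.

Lemma slice_eval (f : {scalar A}) b a :
  f (slice b a) = \sum_(u <- comul X b) phi (a * u.1) * f u.2.
Proof. by rewrite linear_sum; apply: eq_bigr => u _; rewrite linearZ. Qed.

End Slice.

(** * Nondegeneracy of the integral *)

Lemma scalar_separates (k : fieldType) (V : vectType k) (u v : V) :
  (forall f : {scalar V}, f u = f v) -> u = v.
Proof.
move=> Ef; rewrite (coord_vbasis (memvf u)) (coord_vbasis (memvf v)).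
apply: eq_bigr => i _; congr (_ *: _).
exact: (Ef (coord (vbasis fullv) i : {scalar V})).
Qed.

Lemma linear_comb (k : fieldType) (U V : lmodType k) (g : U -> V) (I : Type)
    (r : seq I) (c : I -> k) (v : I -> U) :
  linear g -> g (\sum_(i <- r) c i *: v i) = \sum_(i <- r) c i *: g (v i).
Proof.
move=> gl; pose mlin := GRing.isLinear.Build k U V *:%R g gl.
pose G : {linear U -> V} := HB.pack g mlin.
rewrite -[g]/(G : U -> V) linear_sum.
by apply: eq_bigr => i _; rewrite linearZ.
Qed.

Section Frobenius.

Variables (k : fieldType) (A : falgType k) (X : hopf_structure A).
Variables (phi : {scalar A}) (rho : {lrmorphism A -> A}).
Hypothesis phi_neq0 : exists h, phi h != 0.
Hypothesis phi_int : dual_right_integral X phi.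
Hypothesis rho_nak : nakayama phi rho.

Local Notation slice := (slice X phi).

(** Convolving phi with a functional f evaluates f at this slice, and the
    functionals of a finite dimensional space separate its points. *)
Lemma slice1 b : slice b 1 = (phi b)%:A.
Proof.
apply: scalar_separates => f; rewrite slice_eval linearZ /= mulrC -phi_int.
by apply: eq_bigr => u _; rewrite mul1r.
Qed.

(** Written on the basis (e_j) of the second factor, the coproduct of b is the
    sum of the tensors comul_coef b j (x) e_j. *)
Definition comul_coef (b : A) (j : 'I_(\dim {: A})) : A :=
  \sum_(u <- comul X b) coord (vbasis {: A}) j u.2 *: u.1.

Lemma split_comul (V : lmodType k) (f : A -> A -> V) b : bilinear_map f ->
  \sum_(u <- comul X b) f u.1 u.2 =
  \sum_j f (comul_coef b j) (vbasis {: A})`_j.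
Proof.
case=> fl fr; under [RHS]eq_bigr => j _ do rewrite (linear_comb _ _ _ (fr _)).
rewrite exchange_big /=; apply: eq_bigr => u _.
by rewrite {1}(coord_vbasis (memvf u.2)) (linear_comb _ _ _ (fl _)).
Qed.

(** Let R be the radical of phi, which is a two-sided ideal because of rho.  By
    assumption the coproduct of R lies in R (x) H.  For b in R, the sum of
    b_1 S(b_2) is then in R; it equals the scalar counit b, which must vanish as
    phi is nonzero.  So the counit is zero on R, and b, which is the sum of
    counit(b_1) b_2 with b_1 in R, is zero. *)
Lemma frobenius_nondegenerate :
    (forall b, (forall a, phi (a * b) = 0) -> forall a, slice b a = 0) ->
  forall b, (forall a, phi (a * b) = 0) -> b = 0.
Proof.
move=> rad_coideal; have [_ nak] := rho_nak.
pose e := vbasis {: A}; pose c b j := comul_coef b j.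
have rad_c b : (forall a, phi (a * b) = 0) -> forall j a, phi (a * c b j) = 0.
  move=> radb j a; have := slice_eval X phi (coord e j : {scalar A}) b a.
  rewrite rad_coideal // linear0 => E0; rewrite mulr_sumr linear_sum [RHS]E0.
  by apply: eq_bigr => u _; rewrite -scalerAr linearZ /= mulrC.
have rad_eps b : (forall a, phi (a * b) = 0) -> counit X b = 0.
  move=> radb; apply/eqP/negPn/negP => eps_b; have [h /eqP[]] := phi_neq0.
  have bf : bilinear_map (fun p q => p * antipode X q).
    split=> [p|q] z y w; first by rewrite linearP mulrDr -scalerAr.
    by rewrite mulrDl -scalerAl.
  have := antipoder X b; rewrite (split_comul _ bf) => E.
  apply: (mulfI eps_b); rewrite mulr0 -linearZ /=.
  have ->: counit X b *: h = h * (counit X b)%:A by rewrite -scalerAr mulr1.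
  rewrite -E mulr_sumr linear_sum big1 // => j _.
  by rewrite mulrA nak mulrA rad_c.
move=> b radb; rewrite -(counitl X b).
have bf : bilinear_map (fun p q : A => counit X p *: q).
  split=> [p|q] z y w; first by rewrite scalerDr !scalerA mulrC.
  by rewrite linearP scalerDl scalerA.
rewrite (split_comul _ bf) big1 // => j _.
by rewrite rad_eps ?scale0r // => a; apply: rad_c.
Qed.

End Frobenius.

(** * Eigenspaces of an algebra endomorphism *)

Section Components.

Variables (k : fieldType) (A : falgType k) (rho : {lrmorphism A -> A}).

Local Notation A_ := (nakayama_component rho).

Lemma mem_component w h : (h \in A_ w) = (rho h == w *: h).
Proof. by rewrite memv_ker !lfun_simp subr_eq0. Qed.

Lemma iter_component m w h : h \in A_ w -> iter m rho h = w ^+ m *: h.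
Proof.
rewrite mem_component => /eqP Eh; elim: m => [|m IH].
  by rewrite expr0 scale1r.
by rewrite iterS IH linearZ /= Eh scalerA exprSr.
Qed.

Lemma component_mul w w' : (A_ w * A_ w' <= A_ (w * w')%R)%VS.
Proof.
apply/prodvP => a b; rewrite !mem_component => /eqP Ea /eqP Eb.
by rewrite rmorphM /= Ea Eb -scalerAl -scalerAr scalerA.
Qed.

(** Eigenvectors for distinct eigenvalues: applying rho - v to a relation among
    them removes the term of eigenvalue v. *)
Lemma component_indep (s : seq k) (f : k -> A) :
    uniq s -> (forall w, w \in s -> f w \in A_ w) ->
  \sum_(w <- s) f w = 0 -> forall w, w \in s -> f w = 0.
Proof.
elim: s f => [|v s IH] f //= /andP[vs us] fA; rewrite big_cons => sf0.
have fE w : w \in v :: s -> rho (f w) = w *: f w.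
  by move=> /fA; rewrite mem_component => /eqP.
have fs w : w \in s -> f w = 0.
  move=> ws; have /eqP : (w - v) *: f w = 0.
    apply: (IH (fun w => (w - v) *: f w)) => // [u su|].
      by apply/memvZ/fA; rewrite inE su orbT.
    have sf : \sum_(w <- s) f w = - f v.
      by apply/eqP; rewrite -addr_eq0 addrC sf0.
    have := congr1 rho sf0; rewrite linear0 linearD /= fE ?mem_head //.
    rewrite linear_sum (eq_big_seq (fun w => w *: f w)) => [E|u su].
      under eq_bigr do rewrite scalerBl.
      by rewrite sumrB -scaler_sumr sf scalerN opprK addrC.
    by rewrite /= fE // inE su orbT.
  rewrite scaler_eq0 subr_eq0 => /orP[/eqP wv|/eqP //].
  by rewrite -wv ws in vs.
move=> w; rewrite inE => /predU1P[->|/fs //].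
by move: sf0; rewrite big_seq big1 ?addr0.
Qed.

End Components.

(** * The Nakayama automorphism of a lifting *)

Section Lifting.

Variables (k : fieldType) (gT : finGroupType) (n : nat).
Variables (D : lifting_datum k gT n) (H : falgType k).
Variables (iota : gT -> H) (x : 'I_n -> H).
Hypothesis presH : lifting_presentation D iota x.
Variables (X : hopf_structure H) (hopfH : lifting_hopf D iota x X).
Variables (phi : {scalar H}) (rho : {lrmorphism H -> H}).
Hypothesis phi_neq0 : exists h, phi h != 0.
Hypothesis phi_int : dual_right_integral X phi.
Hypothesis rho_nak : nakayama phi rho.
Variables (t : H) (alpha : {lrmorphism H -> k | *%R}).
Hypothesis t_neq0 : t != 0.
Hypothesis t_int : right_integral X t.
Hypothesis alpha_mod : modular t alpha.

Local Notation slice := (slice X phi).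
Local Notation gen := (qg D).

Lemma iotaV a : iota a * iota a^-1%g = 1.
Proof. by case: presH => [[r1 rM _ _ _] _]; rewrite -rM mulgV r1. Qed.

Lemma iotaVl a : iota a^-1%g * iota a = 1.
Proof. by rewrite -{2}[a]invgK iotaV. Qed.

(** The next four identities are the coproducts of the generators, read through
    phi; on the right, rho moves the generator to the front of the argument. *)
Lemma slice_iota_mul a b h :
  slice (iota a * b) h = iota a * slice b (h * iota a).
Proof.
case: hopfH => Dg _ _ _ _.
rewrite [LHS](comul_mull_sum b (slice_bilinear phi h) (Dg a)) mulr_sumr.
by apply: eq_bigr => v _; rewrite big_seq1 scalerAr mulrA.
Qed.

Lemma slice_x_mul i b h :
  slice (x i * b) h = x i * slice b (h * iota (gen i)) + slice b (h * x i).
Proof.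
case: hopfH => _ Dx _ _ _.
rewrite [LHS](comul_mull_sum b (slice_bilinear phi h) (Dx i)) mulr_sumr.
rewrite -big_split; apply: eq_bigr => v _.
by rewrite big_cons big_seq1 /= scalerAr !mulrA mul1r.
Qed.

Lemma slice_mul_iota a b h :
  slice (b * iota a) h = slice b (rho (iota a) * h) * iota a.
Proof.
case: hopfH => Dg _ _ _ _; case: rho_nak => _ nak.
rewrite [LHS](comul_mulr_sum b (slice_bilinear phi h) (Dg a)) mulr_suml.
by apply: eq_bigr => v _; rewrite big_seq1 -scalerAl mulrA nak mulrA.
Qed.

Lemma slice_mul_x i b h :
  slice (b * x i) h =
  slice b (rho (iota (gen i)) * h) * x i + slice b (rho (x i) * h).
Proof.
case: hopfH => _ Dx _ _ _; case: rho_nak => _ nak.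
rewrite [LHS](comul_mulr_sum b (slice_bilinear phi h) (Dx i)) mulr_suml.
rewrite -big_split; apply: eq_bigr => v _.
rewrite big_cons big_seq1 /= -scalerAl !mulrA mulr1.
by rewrite (nak _ (iota _)) (nak _ (x i)) !mulrA.
Qed.

Lemma slice0 b : slice b 0 = 0.
Proof. by rewrite [LHS]big1 // => u _; rewrite mul0r linear0 scale0r. Qed.

Lemma slice0l h : slice 0 h = 0.
Proof.
have := slice_linearl X phi h (-1) 0 0.
by rewrite scaleN1r oppr0 addr0 scaleN1r addNr.
Qed.

Lemma sliceZ b c h : slice b (c *: h) = c *: slice b h.
Proof. by have := slice_linear X phi b c h 0; rewrite !addr0 slice0 addr0. Qed.

Lemma sliceZl c b h : slice (c *: b) h = c *: slice b h.
Proof.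
by have := slice_linearl X phi h c b 0; rewrite !addr0 slice0l addr0.
Qed.

(** The coideal property of the radical: the a with slice b a = 0 for all b in
    the radical contain 1 and are stable under right multiplication by the
    generators, because c b stays in the radical for every c. *)
Lemma phi_nondegenerate b : (forall a, phi (a * b) = 0) -> b = 0.
Proof.
apply: (frobenius_nondegenerate phi_neq0 rho_nak) => {}b radb a.
move: a b radb; apply: (presentation_ind presH).
- split=> [b _|c a a' IHa IHa' b radb]; first exact: slice0.
  by rewrite slice_linear IHa // IHa' // scaler0 addr0.
- by move=> b radb; rewrite (slice1 phi_int) -[b]mul1r radb scale0r.
- move=> h a IH b radb.
  have := slice_iota_mul a b h; rewrite IH => [E|d]; last by rewrite mulrA radb.
  by rewrite -[LHS]mul1r -(iotaVl a) -mulrA -E mulr0.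
move=> h i IH b radb.
have := slice_x_mul i b h; rewrite IH => [|d]; last by rewrite mulrA radb.
suff ->: slice b (h * iota (gen i)) = 0 by rewrite mulr0 add0r.
have := slice_iota_mul (gen i) b h.
rewrite IH => [E|d]; last by rewrite mulrA radb.
by rewrite -[LHS]mul1r -(iotaVl (gen i)) -mulrA -E mulr0.
Qed.

(** As t h is a multiple of t, phi t = 0 would put t in the radical of phi. *)
Lemma phi_t_neq0 : phi t != 0.
Proof.
have [[rho' _ rho'K] nak] := rho_nak.
apply: contraNneq t_neq0 => phit0; apply/eqP/phi_nondegenerate => a.
by rewrite -[a]rho'K -nak t_int linearZ /= phit0 mulr0.
Qed.

Lemma alpha_iota_neq0 a : alpha (iota a) != 0.
Proof.
apply/eqP=> ag0; have := congr1 alpha (iotaV a).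
by rewrite rmorphM /= ag0 mul0r rmorph1 => /eqP; rewrite eq_sym oner_eq0.
Qed.

(** Applying alpha to g_i x_i = q_ii x_i g_i, where q_ii is not 1. *)
Lemma alpha_x i : alpha (x i) = 0.
Proof.
case: presH => [[_ _ rgx _ _] _].
have := congr1 alpha (rgx (gen i) i).
rewrite linearZ !rmorphM /= => E; apply/eqP.
have : (1 - qchar D i (gen i)) * (alpha (x i) * alpha (iota (gen i))) == 0.
  by rewrite mulrBl mul1r -E mulrC subrr.
rewrite mulf_eq0 subr_eq0 eq_sym (negPf (qchar_neq1 _ _)) /=.
by rewrite mulf_eq0 (negPf (alpha_iota_neq0 _)) orbF.
Qed.

Lemma slice_t_iota a :
  slice t (iota a) = (alpha (iota a) * phi t) *: iota a^-1%g.
Proof.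
have := slice_iota_mul a t 1.
rewrite alpha_mod sliceZl (slice1 phi_int) mul1r => E.
by rewrite -[LHS]mul1r -(iotaVl a) -mulrA -E scalerA -scalerAr mulr1.
Qed.

Lemma slice_t_x i :
  slice t (x i) = - (alpha (iota (gen i)) * phi t) *: (x i * iota (gen i)^-1%g).
Proof.
have := slice_x_mul i t 1; rewrite alpha_mod alpha_x scale0r slice0l !mul1r.
rewrite slice_t_iota -scalerAr scaleNr => /esym/eqP.
by rewrite addrC addr_eq0 => /eqP.
Qed.

Lemma slice_t_rho_iota a h :
  slice t (rho (iota a) * h) = slice t h * iota a^-1%g.
Proof.
have [_ _ [epsg _] _ _] := hopfH; have := slice_mul_iota a t h.
by rewrite t_int epsg scale1r => ->; rewrite -mulrA iotaV mulr1.
Qed.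

Lemma slice_t_rho_x i h :
  slice t (rho (x i) * h) = - (slice t h * iota (gen i)^-1%g * x i).
Proof.
have [_ _ [_ epsx] _ _] := hopfH; have := slice_mul_x i t h.
rewrite t_int epsx scale0r slice0l slice_t_rho_iota.
by move=> /esym/eqP; rewrite addrC addr_eq0 => /eqP.
Qed.

(** By slice_t_rho_iota and slice_t_rho_x the image is stable under right
    multiplication by the generators, and it contains 1 as phi t is invertible;
    so the map is onto, and H is finite dimensional. *)
Lemma slice_t_inj : injective (slice t).
Proof.
have surj h : exists a, slice t a = h.
  move: h; apply: (presentation_ind presH) => [||h a [b <-]|h i [b <-]].
  - split; first by exists 0; apply: slice0.
    by move=> c a b [a' <-] [b' <-]; exists (c *: a' + b'); apply: slice_linear.
  - exists ((phi t)^-1 *: 1); rewrite sliceZ (slice1 phi_int) scalerA.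
    by rewrite mulVf ?scale1r // phi_t_neq0.
  - by exists (rho (iota a^-1%g) * b); rewrite slice_t_rho_iota invgK.
  (* The inner factor undoes the g_i^-1 that appears in slice_t_rho_x. *)
  exists (- (rho (x i) * (rho (iota (gen i)^-1%g) * b))).
  rewrite -scaleN1r sliceZ scaleN1r slice_t_rho_x slice_t_rho_iota invgK opprK.
  by rewrite -[_ * _ * iota _^-1]mulrA iotaV mulr1.
pose mlin := GRing.isLinear.Build k H H *:%R _ (slice_linear X phi t).
pose f := linfun (HB.pack (slice t) mlin : {linear H -> H}).
have fE a : f a = slice t a by rewrite lfunE.
have lf : limg f = fullv.
  apply/eqP; rewrite eqEsubv subvf; apply/subvP => h _.
  by have [a <-] := surj h; rewrite -fE memv_img ?memvf.
have kf : lker f == 0%VS.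
  by rewrite -dimv_eq0 -(eqn_add2r (\dim (limg f))) -{1}(capfv (lker f))
    limg_ker_dim lf.
by move=> a b; rewrite -!fE; apply/lker0P.
Qed.

(** Both sides have the same slice along t: the left one by t g = t, the right
    one by g t = alpha(g) t. *)
Lemma nakayama_iota a : rho (iota a) = (alpha (iota a))^-1 *: iota a.
Proof.
apply: slice_t_inj; rewrite -[rho _]mulr1 slice_t_rho_iota (slice1 phi_int).
rewrite sliceZ slice_t_iota scalerA mulKf ?alpha_iota_neq0 //.
by rewrite -scalerAl mul1r.
Qed.

(** Here t x_i = 0 and x_i t = 0 are compared; the factor q_ii appears when x_i
    is moved across the inverse of g_i. *)
Lemma nakayama_x i :
  rho (x i) = ((alpha (iota (gen i)))^-1 * (qmat D i i)^-1) *: x i.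
Proof.
have gx := rel_gx presH.1 (gen i)^-1%g i.
have qinv : qchar D i (gen i) * qchar D i (gen i)^-1%g = 1.
  by rewrite -qcharM mulgV qchar1.
apply: slice_t_inj; rewrite -[rho _]mulr1 slice_t_rho_x (slice1 phi_int).
rewrite sliceZ slice_t_x -scalerAl mul1r -scalerAl gx !scalerA -scaleNr.
congr (_ *: _); rewrite /qmat (mulr1_eq qinv) mulrN mulrCA mulrC -!mulrA.
by rewrite mulVKf // alpha_iota_neq0.
Qed.

(** * The grading and the counit *)

Local Notation L1 := (nakayama_group D iota alpha).
Local Notation L2 := (char_image iota alpha).
Local Notation H_ := (nakayama_component rho).

Lemma iota_component a : iota a \in H_ (alpha (iota a))^-1.
Proof. by rewrite mem_component nakayama_iota. Qed.

Lemma x_component i :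
  x i \in H_ ((alpha (iota (gen i)))^-1 * (qmat D i i)^-1).
Proof. by rewrite mem_component nakayama_x. Qed.

Lemma alpha_iota_group a : L1 (alpha (iota a)).
Proof. by apply: MulSpanGen; right; exists a. Qed.

Lemma alpha_iotaV a : alpha (iota a^-1%g) = (alpha (iota a))^-1.
Proof. by symmetry; apply: mulr1_eq; rewrite -rmorphM iotaV rmorph1. Qed.

Lemma nakayama_group_neq0 w : L1 w -> w != 0.
Proof.
elim=> {w} [w [[i ->]|[a ->]]||w w' _ w0 _ w'0|w _ w0].
- apply/eqP=> q0; have := qcharM D i (gen i) (gen i)^-1%g.
  rewrite mulgV qchar1 -[qchar D i _]/(qmat D i i) q0 mul0r => /eqP.
  by rewrite oner_eq0.
- exact: alpha_iota_neq0.
- exact: oner_neq0.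
- exact: mulf_neq0.
by rewrite invr_eq0.
Qed.

(** The generators lie in components indexed by L1, which is stable under
    products. *)
Lemma component_span h :
  exists2 s : seq k, (forall w, w \in s -> L1 w)
    & h \in (\sum_(w <- s) H_ w)%VS.
Proof.
pose P h := exists2 s : seq k, (forall w, w \in s -> L1 w)
    & h \in (\sum_(w <- s) H_ w)%VS.
have PM g u w : P g -> L1 w -> u \in H_ w -> P (g * u).
  case=> s Ls gs Lw uw; exists [seq v * w | v <- s].
    by move=> _ /mapP[v /Ls Lv ->]; apply: MulSpanM.
  apply: (subvP _ _ (memv_mul gs uw)); rewrite big_map big_distrl /=.
  elim/big_rec2: _ => [|v U U' _ sUU']; first exact: subvv.
  exact: addvS (component_mul _ _ _) sUU'.
rewrite -/(P h); move: h; apply: (presentation_ind presH) => [||h a Ph|h i Ph].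
- split=> [|c a b [s Ls sa] [r Lr rb]]; first by exists [::]; rewrite ?mem0v.
  exists (s ++ r) => [w|]; first by rewrite mem_cat => /orP[]; auto.
  by rewrite big_cat memv_add ?memvZ.
- exists [:: 1] => [w|]; first by rewrite inE => /eqP->; apply: MulSpan1.
  by rewrite big_seq1 mem_component rmorph1 scale1r.
- by apply: (PM _ _ _ Ph _ (iota_component a)); apply/MulSpanV/alpha_iota_group.
apply: (PM _ _ _ Ph _ (x_component i)); apply: MulSpanM; apply: MulSpanV.
  exact: alpha_iota_group.
by apply: MulSpanGen; left; exists i.
Qed.

Definition alpha_values : seq k := undup [seq alpha (iota a) | a <- enum gT].

Lemma alpha_valuesP w : reflect (L2 w) (w \in alpha_values).
Proof.
rewrite mem_undup; apply: (iffP mapP) => [[a _ ->]|[a ->]]; first by exists a.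
by exists a; rewrite ?mem_enum.
Qed.

(** Lagrange for the finite group alpha(G), by the classical argument: scaling
    by an element permutes the group, so it preserves the product of all its
    elements. *)
Lemma alpha_iota_exp a : alpha (iota a) ^+ size alpha_values = 1.
Proof.
set c := alpha (iota a); have c0 : c != 0 := alpha_iota_neq0 a.
have pm : perm_eq [seq c * v | v <- alpha_values] alpha_values.
  have sub : {subset [seq c * v | v <- alpha_values] <= alpha_values}.
    move=> _ /mapP[_ /alpha_valuesP[b ->] ->].
    apply/alpha_valuesP; exists (a * b)%g.
    by rewrite (rel_mul presH.1) rmorphM.
  have un : uniq [seq c * v | v <- alpha_values].
    by rewrite map_inj_uniq ?undup_uniq //; apply: mulfI.
  apply: uniq_perm; rewrite ?undup_uniq //.
  by have [_] := uniq_min_size un sub (eq_leq (esym (size_map _ _))).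
have p0 : \prod_(v <- alpha_values) v != 0.
  rewrite prodf_seq_neq0; apply/allP => _ /alpha_valuesP[b ->] /=.
  exact: alpha_iota_neq0.
apply: (mulIf p0); rewrite mul1r -[RHS](perm_big _ pm) big_map big_split /=.
by rewrite big_const_seq count_predT -Monoid.iteropE.
Qed.

(** Both sides are multiplicative in h, agree on G because M-th powers in
    alpha(G) are 1, and vanish at the x_i. *)
Lemma counit_nakayama_exp h :
  counit X (iter (size alpha_values) rho h) = counit X h.
Proof.
have [_ _ [_ epsx] _ _] := hopfH.
have iterM m a b : iter m rho (a * b) = iter m rho a * iter m rho b.
  by elim: m => //= m ->; rewrite rmorphM.
have iterP m c a b :
    iter m rho (c *: a + b) = c *: iter m rho a + iter m rho b.
  by elim: m => //= m ->; rewrite linearP.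
have iter0 m : iter m rho 0 = 0 by elim: m => //= m ->; rewrite linear0.
have iter1 m : iter m rho 1 = 1 by elim: m => //= m ->; rewrite rmorph1.
move: h; apply: (presentation_ind presH) => [||h a IH|h i IH].
- by split=> [|c a b IHa IHb]; rewrite ?iter0 // iterP !linearP /= IHa IHb.
- by rewrite iter1.
- rewrite iterM (iter_component _ (iota_component a)) exprVn alpha_iota_exp.
  by rewrite invr1 scale1r !rmorphM /= IH.
rewrite iterM (iter_component _ (x_component i)) -scalerAr linearZ !rmorphM /=.
by rewrite epsx !mulr0.
Qed.

(** With M the order of alpha(G), the invariance of the counit under rho^M gives
    w^M = 1.  The M elements of alpha(G) are roots of X^M - 1, which has no
    room for another root. *)
Lemma counit_component w h : h \in H_ w -> counit X h != 0 -> L2 w.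
Proof.
move=> Eh eps_h; apply/alpha_valuesP.
have wM : w ^+ size alpha_values = 1.
  apply: (mulIf eps_h); rewrite mul1r -[RHS]counit_nakayama_exp.
  by rewrite (iter_component _ Eh) linearZ.
have M0 : (0 < size alpha_values)%N.
  have : alpha (iota 1%g) \in alpha_values by apply/alpha_valuesP; exists 1%g.
  by case: alpha_values.
apply: contraT => wS.
have := @max_poly_roots _ ('X^(size alpha_values) - 1) (w :: alpha_values).
rewrite size_XnsubC // ltnn; apply.
- by rewrite -size_poly_gt0 size_XnsubC.
- apply/allP => v; rewrite inE rootE !hornerE.
  case/orP=> [/eqP->|/alpha_valuesP[a ->]].
    by rewrite wM subrr.
  by rewrite alpha_iota_exp subrr.
by rewrite /= wS undup_uniq.
Qed.

End Lifting.

Theorem theorem4p3 (k : fieldType) (gT : finGroupType) (n : nat)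
    (D : lifting_datum k gT n)
    (H : falgType k) (iota : gT -> H) (x : 'I_n -> H)
    (presH : lifting_presentation D iota x)
    (X : hopf_structure H) (hopfH : lifting_hopf D iota x X)
    (phi : {scalar H}) (phi_neq0 : exists h, phi h != 0)
    (phi_int : dual_right_integral X phi)
    (rho : {lrmorphism H -> H}) (rho_nak : nakayama phi rho)
    (t : H) (t_neq0 : t != 0) (t_int : right_integral X t)
    (alpha : {lrmorphism H -> k | *%R}) (alpha_mod : modular t alpha) :
  let L1 := nakayama_group D iota alpha in
  let L2 := char_image iota alpha in
  let H_ := nakayama_component rho in
  group_grading L1 H_ /\
  [<-> strongly_graded L1 H_;
       forall w, L1 w -> exists a : gT, iota a \in H_ w;
       forall w, L1 w <-> L2 w;
       crossed_product L1 H_].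
Proof.
move=> L1 L2 H_.
have iotaH a : iota a \in H_ (alpha (iota a))^-1.
  exact: (iota_component presH hopfH phi_neq0 phi_int rho_nak t_neq0
    t_int alpha_mod).
have iotaVH a : iota a^-1%g \in H_ (alpha (iota a)).
  by have := iotaH a^-1%g; rewrite (alpha_iotaV presH) invrK.
have L1_neq0 w : L1 w -> w != 0.
  exact: (@nakayama_group_neq0 _ _ _ _ _ _ _ presH).
have iota_unit a : iota a \is a GRing.unit.
  by apply/unitrP; exists (iota a^-1%g); rewrite (iotaV presH) (iotaVl presH).
split.
  split=> [w w' _ _|h|s f us fH sf0].
  - exact: component_mul.
  - exact: (component_span presH hopfH phi_neq0 phi_int rho_nak t_neq0
    t_int alpha_mod).
  by apply: (@component_indep _ _ rho s f us _ sf0) => w /fH[].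
tfae.
- move=> strong w Lw; suff [a ->]: L2 w by exists a^-1%g.
  apply/alpha_valuesP/negPn/negP => /alpha_valuesP nL2w.
  have : 1 \in H_ 1 by rewrite mem_component rmorph1 scale1r.
  rewrite -(mulfV (L1_neq0 w Lw)) -strong //; last exact: MulSpanV.
  move=> s1; have: counit X 1 = 0.
    move: s1.
    apply: (@prodv_lin_closed _ _ (fun h => counit X h = 0)) => [|a b wa _].
      split=> [|c a b ea eb]; first exact: linear0.
      by rewrite linearP /= ea eb addr0 mulr0.
    rewrite rmorphM /=.
    have [->|ea] := eqVneq (counit X a) 0; first exact: mul0r.
    case: nL2w; apply: (counit_component presH hopfH phi_neq0 phi_int rho_nak
      t_neq0 t_int alpha_mod wa ea).
  by rewrite rmorph1 => /eqP; rewrite oner_eq0.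
- move=> comps w; split=> [Lw|[a ->]]; last exact: alpha_iota_group.
  have [a] := comps w Lw; rewrite mem_component => /eqP Ew.
  have := iotaH a; rewrite mem_component Ew => /eqP Ea; exists a^-1%g.
  rewrite (alpha_iotaV presH); apply/eqP; rewrite -subr_eq0.
  have /eqP : (w - (alpha (iota a))^-1) *: iota a = 0.
    by rewrite scalerBl Ea subrr.
  rewrite scaler_eq0 => /orP[//|/eqP ia0].
  by have := iota_unit a; rewrite ia0 unitr0.
- by move=> eqL w /eqL[a ->]; exists (iota a^-1%g).
(* For a unit h of degree w, every b of degree w w' is h (h^-1 b). *)
move=> crossed w w' Lw Lw'; apply/eqP; rewrite eqEsubv component_mul.
have [h] := crossed w Lw; rewrite mem_component => /eqP hw hU.
apply/subvP => b; rewrite mem_component => /eqP bw.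
rewrite -[b](mulVKr hU); apply: memv_mul; first by rewrite mem_component hw.
rewrite mem_component rmorphM rmorphV //= hw bw invrZ ?unitfE ?L1_neq0 //.
by rewrite -scalerAl -scalerAr scalerA mulKf ?L1_neq0.
Qed.
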